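(* Let $n\ge 2$. The welded braid group $WB_n$ has the following reduced presentation, with generators $\sigma_1, v_1,\ldots,v_{n-1}$ (the elements of $WB_n$ of the same names) and defining relations: $$\begin{array}{l} v_i v_{i+1} v_i = v_{i+1} v_i v_{i+1},\\ v_i v_j = v_j v_i,\quad j\neq i\pm 1,\\ v_i^2 = 1,\quad 1\le i\le n-1,\\ \sigma_1 v_j = v_j\sigma_1,\quad j>2,\\ (v_1\sigma_1 v_1)(v_2\sigma_1 v_2)(v_1\sigma_1 v_1) = (v_2\sigma_1 v_2)(v_1\sigma_1 v_1)(v_2\sigma_1 v_2),\\ v_1(v_2\sigma_1v_2v_1\sigma_1) = (v_2\sigma_1v_2v_1\sigma_1)v_2,\\ \sigma_1(v_2v_3v_1v_2\sigma_1v_2v_1v_3v_2) = (v_2v_3v_1v_2\sigma_1v_2v_1v_3v_2)\sigma_1. \end{array}$$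
   Context: The welded braid group $WB_n$ is the group with generators $\sigma_1,\ldots,\sigma_{n-1}$ (braid generators) and $v_1,\ldots,v_{n-1}$ (welded generators) and the following relations: braid relations $\sigma_i\sigma_{i+1}\sigma_i=\sigma_{i+1}\sigma_i\sigma_{i+1}$ and $\sigma_i\sigma_j=\sigma_j\sigma_i$ for $|i-j|\ge 2$; $v_i^2=1$, $v_iv_{i+1}v_i=v_{i+1}v_iv_{i+1}$, and $v_iv_j=v_jv_i$ for $|i-j|\ge 2$; mixed relations $\sigma_iv_j=v_j\sigma_i$ for $|i-j|\ge 2$ and $v_i\sigma_{i+1}v_i=v_{i+1}\sigma_iv_{i+1}$; the first forbidden move relations $v_i\sigma_{i+1}\sigma_i=\sigma_{i+1}\sigma_iv_{i+1}$. In $WB_n$ the other braid generators are expressed through the generators of the reduced presentation by $$\sigma_{i+1} = (v_i\cdots v_2v_1)(v_{i+1}\cdots v_3v_2)\,\sigma_1\,(v_2v_3\cdots v_{i+1})(v_1v_2\cdots v_i),\qquad 1\le i\le n-2.$$ In every presentation, a relation is included exactly when all indices occurring in it lie in $\{1,\ldots,n-1\}$. *)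

(* Defs.v *)
(* MathComp, with the classical axioms of mathcomp.classical.boolp. *)
From HB Require Import structures.
From mathcomp Require Import all_boot.
From mathcomp Require Import boolp.

Set Implicit Arguments.
Unset Strict Implicit.
Unset Printing Implicit Defensive.

Local Open Scope group_scope.
Local Open Scope quotient_scope.

(* Formal group expressions over X, before any identification; the operations
   below only provide the syntax *, 1, ^-1 and ^+. *)
Inductive word (X : Type) : Type :=
| Gen of X
| One
| Mul of word X & word X
| Inv of word X.
Arguments One {X}.

HB.instance Definition _ (X : Type) := gen_eqMixin (word X).
HB.instance Definition _ (X : Type) := gen_choiceMixin (word X).
HB.instance Definition _ (X : Type) := hasMul.Build (word X) (@Mul X).
HB.instance Definition _ (X : Type) := hasOne.Build (word X) (@One X).
HB.instance Definition _ (X : Type) := hasInv.Build (word X) (@Inv X).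

(* A relation u = w between words is recorded as R u w. *)
Definition relations (X : Type) := word X -> word X -> Prop.

(* The least congruence containing R whose quotient is a group. *)
Inductive cong (X : Type) (R : relations X) : word X -> word X -> Prop :=
| cong_rel u w : R u w -> cong R u w
| cong_refl u : cong R u u
| cong_sym u w : cong R u w -> cong R w u
| cong_trans u w z : cong R u w -> cong R w z -> cong R u z
| cong_mul u u' w w' : cong R u u' -> cong R w w' -> cong R (u * w) (u' * w')
| cong_inv u u' : cong R u u' -> cong R u^-1 u'^-1
| cong_mulA u w z : cong R (u * (w * z)) (u * w * z)
| cong_mul1 u : cong R (1 * u) u
| cong_mulr1 u : cong R (u * 1) u
| cong_mulV u : cong R (u^-1 * u) 1
| cong_mulrV u : cong R (u * u^-1) 1.

Section PresentedGroup.
Variables (X : Type) (R : relations X).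

Definition congb : rel (word X) := fun u w => `[< cong R u w >].

Lemma congb_refl : reflexive congb.
Proof. by move=> u; apply/asboolP; apply: cong_refl. Qed.

Lemma congb_sym : symmetric congb.
Proof. by move=> u w; apply/asboolP/asboolP => h; apply: cong_sym. Qed.

Lemma congb_trans : transitive congb.
Proof.
move=> w u z /asboolP uw /asboolP wz.
by apply/asboolP; apply: cong_trans uw wz.
Qed.

Canonical cong_equiv := EquivRel congb congb_refl congb_sym congb_trans.

(* The group < X | R >. *)
Definition presented : Type := {eq_quot cong_equiv}.
HB.instance Definition _ := Choice.on presented.

Definition class (u : word X) : presented := \pi_({eq_quot cong_equiv}) u.
Definition word_of (a : presented) : word X :=
  repr (a : {eq_quot cong_equiv}).

Lemma classK a : class (word_of a) = a.
Proof. exact: reprK. Qed.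

Lemma class_eqP u w : class u = class w <-> cong R u w.
Proof. by split=> [/eqquotP /asboolP | h]; last by apply/eqquotP/asboolP. Qed.

Lemma word_of_class u : cong R (word_of (class u)) u.
Proof. by apply/class_eqP; rewrite classK. Qed.

Definition pmul (a b : presented) := class (word_of a * word_of b).
Definition pone : presented := class 1.
Definition pinv (a : presented) := class (word_of a)^-1.

Lemma pmulE u w : pmul (class u) (class w) = class (u * w).
Proof. by apply/class_eqP/cong_mul; apply: word_of_class. Qed.

Lemma pinvE u : pinv (class u) = class u^-1.
Proof. by apply/class_eqP/cong_inv/word_of_class. Qed.

Lemma pmulA : associative pmul.
Proof.
move=> a b c; rewrite -(classK a) -(classK b) -(classK c) !pmulE.
exact/class_eqP/cong_mulA.
Qed.

Lemma pmul1 : left_id pone pmul.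
Proof. by move=> a; rewrite -(classK a) pmulE; apply/class_eqP/cong_mul1. Qed.

Lemma pmulr1 : right_id pone pmul.
Proof. by move=> a; rewrite -(classK a) pmulE; apply/class_eqP/cong_mulr1. Qed.

Lemma pmulV : left_inverse pone pinv pmul.
Proof.
by move=> a; rewrite -(classK a) pinvE pmulE; apply/class_eqP/cong_mulV.
Qed.

Lemma pmulrV : right_inverse pone pinv pmul.
Proof.
by move=> a; rewrite -(classK a) pinvE pmulE; apply/class_eqP/cong_mulrV.
Qed.

HB.instance Definition _ :=
  isGroup.Build presented pmulA pmul1 pmulr1 pmulV pmulrV.

Definition pgen (x : X) : presented := class (Gen x).

End PresentedGroup.

(* G has the presentation < X | R >, the generator x denoting f x in G. *)
Definition has_presentation (G : groupType) (X : Type) (R : relations X)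
    (f : X -> G) : Prop :=
  exists phi : {multiplicative presented R -> G},
    bijective phi /\ forall x, phi (pgen R x) = f x.

(* The indices 1, ..., n-1, numbered from 1; since indices of generators range
   over this type, a relation is present exactly when all its indices are. *)
Definition idx (n : nat) := {i : nat | 0 < i < n}.

Definition idx1 (n : nat) (hn : 1 < n) : idx n := exist _ 1%N hn.

Inductive wb_gen (n : nat) : Type :=
| WSigma of idx n
| WV of idx n.

Section WeldedRelations.
Variable n : nat.
Let s (i : idx n) : word (wb_gen n) := Gen (WSigma i).
Let v (i : idx n) : word (wb_gen n) := Gen (WV i).
Let next (i j : idx n) := val j = (val i).+1.
Let far (i j : idx n) := ((val i).+1 < val j) || ((val j).+1 < val i).

Inductive wb_rel : relations (wb_gen n) :=
| wb_braid i j : next i j -> wb_rel (s i * s j * s i) (s j * s i * s j)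
| wb_braid_far i j : far i j -> wb_rel (s i * s j) (s j * s i)
| wb_v_sqr i : wb_rel (v i ^+ 2) 1
| wb_v_braid i j : next i j -> wb_rel (v i * v j * v i) (v j * v i * v j)
| wb_v_far i j : far i j -> wb_rel (v i * v j) (v j * v i)
| wb_mixed_far i j : far i j -> wb_rel (s i * v j) (v j * s i)
| wb_mixed i j : next i j -> wb_rel (v i * s j * v i) (v j * s i * v j)
| wb_forbidden i j : next i j -> wb_rel (v i * s j * s i) (s j * s i * v j).

End WeldedRelations.

Notation WB n := (presented (@wb_rel n)).

Inductive red_gen (n : nat) : Type :=
| RSigma1
| RV of idx n.
Arguments RSigma1 {n}.

Section ReducedRelations.
Variable n : nat.
Let s1 : word (red_gen n) := Gen RSigma1.
Let v (i : idx n) : word (red_gen n) := Gen (RV i).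

(* Below, i1, i2, i3 stand for the indices 1, 2, 3, when these are < n. *)
Inductive red_rel : relations (red_gen n) :=
| red_v_braid i j : val j = (val i).+1 ->
    red_rel (v i * v j * v i) (v j * v i * v j)
| red_v_comm i j : val j <> (val i).+1 -> val i <> (val j).+1 ->
    red_rel (v i * v j) (v j * v i)
| red_v_sqr i : red_rel (v i ^+ 2) 1
| red_s_comm j : 2 < val j -> red_rel (s1 * v j) (v j * s1)
| red_braid i1 i2 : val i1 = 1%N -> val i2 = 2%N ->
    red_rel
      ((v i1 * s1 * v i1) * (v i2 * s1 * v i2) * (v i1 * s1 * v i1))
      ((v i2 * s1 * v i2) * (v i1 * s1 * v i1) * (v i2 * s1 * v i2))
| red_forbidden i1 i2 : val i1 = 1%N -> val i2 = 2%N ->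
    red_rel
      (v i1 * (v i2 * s1 * v i2 * v i1 * s1))
      ((v i2 * s1 * v i2 * v i1 * s1) * v i2)
| red_far i1 i2 i3 : val i1 = 1%N -> val i2 = 2%N -> val i3 = 3%N ->
    red_rel
      (s1 * (v i2 * v i3 * v i1 * v i2 * s1 * v i2 * v i1 * v i3 * v i2))
      ((v i2 * v i3 * v i1 * v i2 * s1 * v i2 * v i1 * v i3 * v i2) * s1).

End ReducedRelations.

(* The generators of the reduced presentation as elements of WB_n; hn makes
   the index 1 available. *)
Definition red_to_WB (n : nat) (hn : 1 < n) (x : red_gen n) : WB n :=
  match x with
  | RSigma1 => pgen (@wb_rel n) (WSigma (idx1 hn))
  | RV i => pgen (@wb_rel n) (WV i)
  end.

(* Main.v *)
From HB Require Import structures.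
Require Import Defs.
From mathcomp Require Import all_boot zify.

(** Both generating families can be expressed in each other compatibly with the
relations, so the universal property of presented groups ([extend]) gives
homomorphisms [phi : <reduced> -> WB_n] and [psi : WB_n -> <reduced>]; they are
inverse to each other because both composites fix the generators
([presented_endo_id]).

The link between the two presentations is the mixed relation
[v_i s_(i+1) v_i = v_(i+1) s_i v_(i+1)].  As the [v_i] are involutions, it says
exactly that [s_(i+1)] is [s_i] conjugated by [v_(i+1) v_i], so all braid
generators are determined by the first one.  Substituting this definition, the
last three reduced relations turn out to be, up to conjugation and cancellation
of involutions, the braid, forbidden and far commutation relations for the lowest
possible indices: [(1, 2)], [(1, 2)] and [(1, 3)]
([reduced_braidP], [reduced_forbiddenP], [reduced_farP]).  These equivalences
serve in both directions.

What remains for [psi] is to propagate the relations to all indices inside the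
group with the reduced presentation.  The [v_i] satisfy the Coxeter relations of
the symmetric group, and conjugation by the three-term product
[v_(i+2) v_(i+1) v_i] raises by one the indices of [v_i], [v_(i+1)], [s_i] and
[s_(i+1)] simultaneously ([v_shift], [sigma_shift]); it carries the braid and
forbidden relations from [i] to [i+1].  The far relation [s_i s_j = s_j s_i]
is reached from [s_1 s_3 = s_3 s_1] by raising one index at a time
([sigma_far]).  All of this rests on [sigma_v_far]: [s_i] commutes with [v_j]
when [|i - j| >= 2].  Lowering [i] one step at a time reduces it to the
assumption on [s_1], because [v_j] commutes with the conjugating elements met;
the one exception is [j = i - 2], where a computation in the symmetric group
([triple_swap]) lowers [i] by two. *)

Set Implicit Arguments.
Unset Strict Implicit.
Unset Printing Implicit Defensive.

Local Open Scope group_scope.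

(** * The universal property of a presented group *)

Section UniversalProperty.
Variables (X : Type) (R : relations X).

Fixpoint eval (H : groupType) (f : X -> H) (u : word X) : H :=
  match u with
  | Gen x => f x
  | One => 1
  | Mul a b => eval f a * eval f b
  | Inv a => (eval f a)^-1
  end.

Definition respects (H : groupType) (f : X -> H) : Prop :=
  forall u w, R u w -> eval f u = eval f w.

Lemma eval_cong (H : groupType) (f : X -> H) u w :
  respects f -> cong R u w -> eval f u = eval f w.
Proof.
move=> fR; elim=> {u w} //=.
- by move=> u w z _ -> _ ->.
- by move=> u u' w w' _ -> _ ->.
- by move=> u u' _ ->.
- by move=> u w z; rewrite mulgA.
- by move=> u; rewrite mul1g.
- by move=> u; rewrite mulg1.
- by move=> u; rewrite mulVg.
- by move=> u; rewrite mulgV.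
Qed.

Lemma class_mul u w : class R (u * w) = class R u * class R w.
Proof. exact/esym/pmulE. Qed.

Lemma eval_pgen u : eval (pgen R) u = class R u.
Proof.
elim: u => [x||u IHu w IHw|u IHu] //=; first by rewrite IHu IHw -class_mul.
by rewrite IHu; apply: pinvE.
Qed.

Lemma respects_pgen : respects (pgen R).
Proof. by move=> u w Ruw; rewrite !eval_pgen; apply/class_eqP/cong_rel. Qed.

Section Extend.
Variables (H : groupType) (f : X -> H).

(** Taking the proof [fR] as an argument is what lets the morphism structure be
attached to [extend fR]. *)
Definition extend (fR : respects f) (a : presented R) : H := eval f (word_of a).

Hypothesis fR : respects f.

(** The value at a class does not depend on the representative that defines
[extend], since [f] identifies congruent words. *)
Lemma extend_class u : extend fR (class R u) = eval f u.
Proof. exact/eval_cong/word_of_class. Qed.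

Lemma extend_pgen x : extend fR (pgen R x) = f x.
Proof. exact: extend_class. Qed.

Lemma extendM : {morph extend fR : a b / a * b}.
Proof.
by move=> a b; rewrite -(classK a) -(classK b) -class_mul !extend_class.
Qed.

Lemma extend1 : extend fR 1 = 1.
Proof. exact: (extend_class 1). Qed.

HB.instance Definition _ :=
  isUMagmaMorphism.Build (presented R) H (extend fR) (extend1, extendM).

End Extend.

(** Rigidity: the generators generate, so an endomorphism fixing them is the
identity.  Applied to the composites of [phi] and [psi]. *)
Lemma presented_endo_id (h : presented R -> presented R) :
  {morph h : a b / a * b} -> (forall x, h (pgen R x) = pgen R x) -> h =1 id.
Proof.
move=> hM hX a; rewrite -(classK a) -eval_pgen.
have h1 : h 1 = 1 by apply: (mulgI (h 1)); rewrite -hM !mulg1.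
elim: (word_of a) => [x||u hu w hw|u hu] //=; first by rewrite hM hu hw.
by apply: (mulgI (eval (pgen R) u)); rewrite -{1}hu -hM !mulgV.
Qed.

End UniversalProperty.

(** * Conjugation by involutions *)

Section Involutions.
Variable G : groupType.
Implicit Types a b c s x y z : G.

Lemma involV a : a * a = 1 -> a^-1 = a.
Proof. exact: mulg1_eq. Qed.

Lemma conj_invol a x : a * a = 1 -> x ^ a = a * x * a.
Proof. by move=> aa; rewrite conjgE involV // mulgA. Qed.

Lemma conj_involK a x : a * a = 1 -> (x ^ a) ^ a = x.
Proof. by move=> aa; rewrite -conjgM aa conjg1. Qed.

Lemma commute_conj x y z : commute x y -> commute (x ^ z) (y ^ z).
Proof. by rewrite /commute -!conjMg => ->. Qed.

Lemma conjg_commute x y : commute x y -> x ^ y = x.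
Proof. by move=> cxy; rewrite conjgE cxy mulKg. Qed.

(** For involutions the braid relation is a symmetry of conjugation; every
computation with the [v_i] below is done in this form. *)
Lemma braid_conj a b : a * a = 1 -> b * b = 1 ->
  a * b * a = b * a * b -> a ^ b = b ^ a.
Proof. by move=> aa bb ab; rewrite !conj_invol. Qed.

(** Here [a], [b], [c] satisfy the relations of the adjacent transpositions
(1 2), (2 3), (3 4). *)
Section Triple.
Variables a b c : G.
Hypotheses (aa : a * a = 1) (bb : b * b = 1) (cc : c * c = 1).
Hypotheses (ab : a * b * a = b * a * b) (bc : b * c * b = c * b * c).
Hypothesis ac : commute a c.

Lemma triple_shift1 : a ^ (c * b * a) = b.
Proof.
by rewrite !conjgM (conjg_commute ac) (braid_conj aa bb ab) conj_involK.
Qed.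

Lemma triple_shift2 : b ^ (c * b * a) = c.
Proof.
rewrite !conjgM (braid_conj bb cc bc) conj_involK //.
exact/conjg_commute/commute_sym.
Qed.

(** The permutation sends the edge {3, 4} to the edge {1, 2}; the conjugating
element is the one that carries [s_i] to [s_(i+2)]. *)
Lemma triple_swap : c ^ (b * a * (c * b)) = a.
Proof.
rewrite !conjgM -(braid_conj bb cc bc) -(conjgM b c a) -ac conjgM.
by rewrite conj_involK // -(braid_conj aa bb ab) conj_involK.
Qed.

End Triple.

(** With [a = v_1], [b = v_2], [s = s_1], the element [t] is the braid generator
[s_2] (and [r] below is [s_3]).  Since only [tE] is assumed, the equivalences
apply to both groups. *)
Section ReducedForm.
Variables a b s t : G.
Hypotheses (aa : a * a = 1) (bb : b * b = 1) (tE : t = s ^ (b * a)).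

Lemma conj_reduced : s ^ b = t ^ a.
Proof. by rewrite tE conjgM conj_involK. Qed.

(** Both sides of the reduced relation are the sides of the braid relation,
conjugated by [a]. *)
Lemma reduced_braidP :
  (a * s * a) * (b * s * b) * (a * s * a) =
    (b * s * b) * (a * s * a) * (b * s * b) <->
  s * t * s = t * s * t.
Proof.
rewrite -!(conj_invol _ aa) -!(conj_invol _ bb) conj_reduced -!conjMg.
by split=> [/conjg_inj | ->].
Qed.

(** The bracket is [a t s], so the reduced relation is the forbidden one
multiplied by [a] on the left. *)
Lemma reduced_forbiddenP :
  a * (b * s * b * a * s) = (b * s * b * a * s) * b <->
  a * t * s = t * s * b.
Proof.
have -> : b * s * b * a * s = a * (t * s).
  by rewrite -(conj_invol _ bb) conj_reduced (conj_invol _ aa) -!mulgA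
    (mulgA a a) aa mul1g.
rewrite mulgA aa mul1g -!mulgA.
by split=> [-> | <-]; rewrite !mulgA aa !mul1g.
Qed.

(** The long word is the conjugate of [s] by [b a c b], which is [r]. *)
Lemma reduced_farP c r : c * c = 1 -> r = t ^ (c * b) ->
  s * (b * c * a * b * s * b * a * c * b) =
    (b * c * a * b * s * b * a * c * b) * s <->
  commute s r.
Proof.
move=> cc rE.
suff <- : b * c * a * b * s * b * a * c * b = r by [].
by rewrite rE tE !conjgM !conj_invol // !mulgA.
Qed.

End ReducedForm.
End Involutions.

(** * Braid generators from the first one *)

Section Sigma.
Variables (G : groupType) (n : nat) (s1 : G) (v : nat -> G).

(** Numbered from 1 like the braid generators; the value at 0 is arbitrary.  The
step is the mixed relation solved for its higher generator. *)
Fixpoint sigma (i : nat) : G :=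
  if i is j.+1 then if j is 0 then s1 else sigma j ^ (v j.+1 * v j) else s1.

Lemma sigmaS i : 0 < i -> sigma i.+1 = sigma i ^ (v i.+1 * v i).
Proof. by case: i. Qed.

Hypothesis v_sqr : forall i, 0 < i < n -> v i * v i = 1.
Hypothesis v_braid : forall i, 0 < i -> i.+1 < n ->
  v i * v i.+1 * v i = v i.+1 * v i * v i.+1.
Hypothesis v_far : forall i j, 0 < i -> i.+1 < j -> j < n ->
  commute (v i) (v j).

Lemma sigma_mixed i : 0 < i -> i.+1 < n ->
  v i * sigma i.+1 * v i = v i.+1 * sigma i * v i.+1.
Proof.
move=> i0 iN; have vi : v i * v i = 1 by apply: v_sqr; lia.
have vj : v i.+1 * v i.+1 = 1 by apply: v_sqr; lia.
by rewrite -!conj_invol // sigmaS // conjgM conj_involK.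
Qed.

Hypothesis s1_v : forall j, 2 < j -> j < n -> commute s1 (v j).

(** By induction on [i], two steps back when [j = i - 2]: then [v j] does not
commute with the element conjugating [sigma i.-1] to [sigma i], but it is the
conjugate of [v i] by the one taking [sigma j] to [sigma i], and [v i]
commutes with [sigma j].  Otherwise [v j] commutes with both factors of the
conjugating element. *)
Lemma sigma_v_far i j : 0 < i < n -> 0 < j < n -> (i.+1 < j) || (j.+1 < i) ->
  commute (sigma i) (v j).
Proof.
elim/ltn_ind: i j => -[|[|i]] IH j // iN jN ij.
  by apply: s1_v; lia.
have [ji|ji] := eqVneq j i.
  have i0 : 0 < i by lia.
  have a2 : v i * v i = 1 by apply: v_sqr; lia.
  have b2 : v i.+1 * v i.+1 = 1 by apply: v_sqr; lia.
  have c2 : v i.+2 * v i.+2 = 1 by apply: v_sqr; lia.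
  rewrite ji 2?sigmaS // -conjgM.
  rewrite -{2}(triple_swap a2 b2 c2 (v_braid _ _) (v_braid _ _) (v_far _ _ _));
    try lia.
  by apply/commute_conj/IH; lia.
have vjK k : 0 < k < n -> (k.+1 < j) || (j.+1 < k) -> v j ^ v k = v j.
  move=> kN /orP[kj|jk]; apply: conjg_commute.
    by apply/commute_sym/v_far; lia.
  by apply: v_far; lia.
rewrite sigmaS // conjgM -(vjK i.+1) -1?(vjK i.+2); try lia.
do 2!apply: commute_conj.
by apply: IH; lia.
Qed.

(** The 4-cycle on the strands [i, ..., i+3], conjugation by which raises
indices by one. *)
Definition shift i := v i.+2 * v i.+1 * v i.

Lemma v_shift i : 0 < i -> i.+2 < n ->
  v i ^ shift i = v i.+1 /\ v i.+1 ^ shift i = v i.+2.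
Proof.
move=> i0 iN.
have a2 : v i * v i = 1 by apply: v_sqr; lia.
have b2 : v i.+1 * v i.+1 = 1 by apply: v_sqr; lia.
have c2 : v i.+2 * v i.+2 = 1 by apply: v_sqr; lia.
have ac : commute (v i) (v i.+2) by apply: v_far.
split; first by apply: triple_shift1 => //; apply: v_braid; lia.
by apply: triple_shift2 => //; apply: v_braid; lia.
Qed.

Lemma sigma_shift i : 0 < i -> i.+2 < n ->
  sigma i ^ shift i = sigma i.+1 /\ sigma i.+1 ^ shift i = sigma i.+2.
Proof.
move=> i0 iN; rewrite /shift !conjgM; split.
  by rewrite (conjg_commute (sigma_v_far _ _ _)) ?sigmaS ?conjgM //; lia.
rewrite -[(_ ^ v i.+2) ^ v i.+1]conjgM -sigmaS //.
by rewrite conjg_commute //; apply: sigma_v_far; lia.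
Qed.

Lemma sigma_forbidden i :
    (2 < n -> v 1 * sigma 2 * sigma 1 = sigma 2 * sigma 1 * v 2) ->
    0 < i -> i.+1 < n ->
  v i * sigma i.+1 * sigma i = sigma i.+1 * sigma i * v i.+1.
Proof.
move=> base; elim: i => // -[|i] IH _ iN; first exact: base.
have [v1 v2] := v_shift (ltn0Sn i) iN.
have [S1 S2] := sigma_shift (ltn0Sn i) iN.
by rewrite -v1 -v2 -S1 -S2 -!conjMg IH //; lia.
Qed.

Lemma sigma_braid i :
    (2 < n -> sigma 1 * sigma 2 * sigma 1 = sigma 2 * sigma 1 * sigma 2) ->
    0 < i -> i.+1 < n ->
  sigma i * sigma i.+1 * sigma i = sigma i.+1 * sigma i * sigma i.+1.
Proof.
move=> base; elim: i => // -[|i] IH _ iN; first exact: base.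
have [S1 S2] := sigma_shift (ltn0Sn i) iN.
by rewrite -S1 -S2 -!conjMg IH //; lia.
Qed.

(** Conjugation by [v j.+1 * v j], which takes [sigma j] to [sigma j.+1], does
not disturb braid generators far from both: one index of a far pair can be raised
while the other stays. *)
Lemma sigma_step_fixed i j : 0 < i < n -> 0 < j -> j.+1 < n ->
    (i.+1 < j) || (j.+2 < i) ->
  sigma i ^ (v j.+1 * v j) = sigma i.
Proof.
move=> iN j0 jN ij.
by rewrite conjgM !(conjg_commute (sigma_v_far _ _ _)) //; lia.
Qed.

(** Pairs at distance 2 are reached along (k, k+2), (k, k+3), (k+1, k+3), each
move keeping the distance at least 2; then the higher index is raised. *)
Lemma sigma_far i j :
    (3 < n -> commute (sigma 1) (sigma 3)) ->
    0 < i -> i.+1 < j -> j < n ->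
  commute (sigma i) (sigma j).
Proof.
move=> far13.
have step2 : forall k, 0 < k -> k.+2 < n -> commute (sigma k) (sigma k.+2).
  elim=> // -[|k] IH _ kN; first exact: far13.
  rewrite (@sigmaS k.+1) // -(@sigma_step_fixed k.+4 k.+1) //; try lia.
  apply: commute_conj.
  rewrite (@sigmaS k.+3) // -(@sigma_step_fixed k.+1 k.+3) //; try lia.
  by apply/commute_conj/IH; lia.
move=> i0; elim: j => // j IH ij jN.
have [->|ji] := eqVneq j i.+1; first by apply: step2; lia.
rewrite sigmaS -1?(@sigma_step_fixed i j); try lia.
by apply/commute_conj/IH; lia.
Qed.

End Sigma.

(** * The two homomorphisms *)

Section Comparison.
Variable n : nat.

Notation Red := (presented (@red_rel n)).
Notation s1 := (pgen (@red_rel n) RSigma1).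
Notation wb := (pgen (@wb_rel n)).

(** The generators [v_i] indexed by [nat], so that index arithmetic needs no
bound proofs; the value 1 outside [1, n-1] is never met, as all relations
carry their bounds. *)
Definition red_v (i : nat) : Red :=
  if insub i is Some j then pgen (@red_rel n) (RV (j : idx n)) else 1.

Definition WB_to_red (x : wb_gen n) : Red :=
  match x with
  | WSigma i => sigma s1 red_v (val i)
  | WV i => pgen (@red_rel n) (RV i)
  end.

Lemma red_v_val (i : idx n) : pgen (@red_rel n) (RV i) = red_v (val i).
Proof. by rewrite /red_v valK. Qed.

Lemma red_v_idx i (iN : 0 < i < n) :
  red_v i = pgen (@red_rel n) (RV (exist _ i iN)).
Proof. by rewrite red_v_val. Qed.

Lemma red_v_sqr_nat i : 0 < i < n -> red_v i * red_v i = 1.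
Proof.
by move=> iN; rewrite (red_v_idx iN); apply: (respects_pgen (red_v_sqr _)).
Qed.

Lemma red_v_braid_nat i : 0 < i -> i.+1 < n ->
  red_v i * red_v i.+1 * red_v i = red_v i.+1 * red_v i * red_v i.+1.
Proof.
move=> i0 iN; have iN' : 0 < i < n by lia.
rewrite (red_v_idx iN') (@red_v_idx i.+1 iN).
exact: (respects_pgen (red_v_braid _)).
Qed.

Lemma red_v_far_nat i j : 0 < i -> i.+1 < j -> j < n ->
  commute (red_v i) (red_v j).
Proof.
move=> i0 ij jN; have iN' : 0 < i < n by lia.
have jN' : 0 < j < n by lia.
rewrite (red_v_idx iN') (red_v_idx jN').
by apply: (respects_pgen (red_v_comm _ _)) => /=; lia.
Qed.

Lemma s1_red_v j : 2 < j -> j < n -> commute s1 (red_v j).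
Proof.
move=> j2 jN; have jN' : 0 < j < n by lia.
by rewrite (red_v_idx jN'); apply: (respects_pgen (red_s_comm _)).
Qed.

Notation rsigma := (sigma s1 red_v).

Lemma red_sigma_braid12 : 2 < n ->
  rsigma 1 * rsigma 2 * rsigma 1 = rsigma 2 * rsigma 1 * rsigma 2.
Proof.
move=> n2; have i1 : 0 < 1 < n by lia.
have i2 : 0 < 2 < n by lia.
apply/(reduced_braidP (red_v_sqr_nat i1) (red_v_sqr_nat i2) erefl).
rewrite (red_v_idx i1) (red_v_idx i2).
exact: (respects_pgen (red_braid _ _)).
Qed.

Lemma red_sigma_forbidden12 : 2 < n ->
  red_v 1 * rsigma 2 * rsigma 1 = rsigma 2 * rsigma 1 * red_v 2.
Proof.
move=> n2; have i1 : 0 < 1 < n by lia.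
have i2 : 0 < 2 < n by lia.
apply/(reduced_forbiddenP (red_v_sqr_nat i1) (red_v_sqr_nat i2) erefl).
rewrite (red_v_idx i1) (red_v_idx i2).
exact: (respects_pgen (red_forbidden _ _)).
Qed.

Lemma red_sigma_far13 : 3 < n -> commute (rsigma 1) (rsigma 3).
Proof.
move=> n3; have i1 : 0 < 1 < n by lia.
have i2 : 0 < 2 < n by lia.
have i3 : 0 < 3 < n by lia.
apply/(reduced_farP (red_v_sqr_nat i1) (red_v_sqr_nat i2) erefl
  (red_v_sqr_nat i3) erefl).
rewrite (red_v_idx i1) (red_v_idx i2) (red_v_idx i3).
exact: (respects_pgen (red_far _ _ _)).
Qed.

Lemma WB_to_red_respects : respects (@wb_rel n) WB_to_red.
Proof.
have sqr := red_v_sqr_nat; have br := red_v_braid_nat.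
have far := red_v_far_nat; have sv := s1_red_v.
move=> u w [] {u w} [i iN] =>
  [[j jN]|[j jN]||[j jN]|[j jN]|[j jN]|[j jN]|[j jN]]; rewrite /= ?red_v_val /=.
- move=> jE; rewrite jE in jN *.
  by apply: (@sigma_braid _ n) red_sigma_braid12 _ _ => //; lia.
- by case/orP=> ij; [|apply: commute_sym];
    apply: (@sigma_far _ n) red_sigma_far13 _ _ _ => //; lia.
- exact: sqr.
- by move=> jE; rewrite jE in jN *; apply: br; lia.
- by case/orP=> ij; [|apply: commute_sym]; apply: far; lia.
- by move=> ij; apply: (@sigma_v_far _ n).
- by move=> jE; rewrite jE in jN *; apply: (@sigma_mixed _ n) => //; lia.
- move=> jE; rewrite jE in jN *.
  by apply: (@sigma_forbidden _ n) red_sigma_forbidden12 _ _ => //; lia.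
Qed.

Lemma WB_v_sqr i : wb (WV i) * wb (WV i) = 1.
Proof. exact: (respects_pgen (wb_v_sqr i)). Qed.

(** The mixed relation solved for its higher generator: [WB n] satisfies the
recursion that defines [sigma]. *)
Lemma WB_sigma_next (i j : idx n) : val j = (val i).+1 ->
  wb (WSigma j) = wb (WSigma i) ^ (wb (WV j) * wb (WV i)).
Proof.
move=> ij; have /= := respects_pgen (wb_mixed ij).
rewrite -!conj_invol ?WB_v_sqr // conjgM => <-.
by rewrite conj_involK ?WB_v_sqr.
Qed.

Section InWB.
Hypothesis hn : 1 < n.

Lemma red_to_WB_respects : respects (@red_rel n) (red_to_WB hn).
Proof.
have s1E i : val i = 1%N -> WSigma (idx1 hn) = WSigma i.
  by move=> i1; congr WSigma; apply: val_inj.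
move=> u w [] {u w} /=.
- by move=> i j ij; apply: (respects_pgen (wb_v_braid ij)).
- move=> i j ij ji; have [/val_inj <- //|ne] := eqVneq (val i) (val j).
  apply: (respects_pgen (wb_v_far _)).
  by case: i j ij ji ne => [i iN] [j jN] /=; lia.
- by move=> i; apply: WB_v_sqr.
- move=> j j2; apply: (respects_pgen (@wb_mixed_far n (idx1 hn) j _)).
  by rewrite /= j2.
- move=> i1 i2 e1 e2; rewrite (s1E i1 e1).
  have e12 : val i2 = (val i1).+1 := etrans e2 (congr1 S (esym e1)).
  apply/(reduced_braidP (WB_v_sqr i1) (WB_v_sqr i2) (WB_sigma_next e12)).
  exact: (respects_pgen (wb_braid e12)).
- move=> i1 i2 e1 e2; rewrite (s1E i1 e1).
  have e12 : val i2 = (val i1).+1 := etrans e2 (congr1 S (esym e1)).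
  apply/(reduced_forbiddenP (WB_v_sqr i1) (WB_v_sqr i2) (WB_sigma_next e12)).
  exact: (respects_pgen (wb_forbidden e12)).
- move=> i1 i2 i3 e1 e2 e3; rewrite (s1E i1 e1).
  have e12 : val i2 = (val i1).+1 := etrans e2 (congr1 S (esym e1)).
  have e23 : val i3 = (val i2).+1 := etrans e3 (congr1 S (esym e2)).
  have far13 : ((val i1).+1 < val i3) || ((val i3).+1 < val i1).
    by move: e1 e3 => /= -> ->.
  apply/(reduced_farP (WB_v_sqr i1) (WB_v_sqr i2) (WB_sigma_next e12)
    (WB_v_sqr i3) (WB_sigma_next e23)).
  exact: (respects_pgen (wb_braid_far far13)).
Qed.

(** The only point where the composite on [WB n] has to be checked: the element
substituted for a braid generator is mapped back to it. *)
Lemma extend_sigma i (iN : 0 < i < n) :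
  extend red_to_WB_respects (rsigma i) = wb (WSigma (exist _ i iN)).
Proof.
elim: i iN => [//|[|i] IH] iN.
  by rewrite extend_pgen /=; congr (wb (WSigma _)); apply: val_inj.
have iN' : 0 < i.+1 < n by lia.
rewrite (@WB_sigma_next (exist _ i.+1 iN')) // -(IH iN').
rewrite sigmaS // (red_v_idx iN) (red_v_idx iN').
by rewrite gmulfJ gmulfM /= !extend_pgen.
Qed.

End InWB.

End Comparison.

Theorem theorem4 (n : nat) (hn : 1 < n) :
  has_presentation (@red_rel n) (red_to_WB hn).
Proof.
pose phi := extend (red_to_WB_respects hn).
pose psi := extend (@WB_to_red_respects n).
exists phi; split; last exact: extend_pgen.
exists psi; apply: presented_endo_id.
- by move=> a b; exact: etrans (congr1 _ (extendM _ _ _)) (extendM _ _ _).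
- by case=> [|i]; rewrite /= /phi /psi !extend_pgen.
- by move=> a b; exact: etrans (congr1 _ (extendM _ _ _)) (extendM _ _ _).
- case=> [[i iN]|i]; rewrite /= /phi /psi extend_pgen ?extend_pgen //.
  exact: extend_sigma.
Qed.
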